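(* Let $m<n$ be positive integers, $\gamma\in\mathbb{R}$, $\Psi\in\mathbb{R}^{n\times m}$ of full column rank, $M\in\mathbb{R}^{m\times m}$ symmetric and invertible, and let $B=\gamma I+\Psi M^{-1}\Psi^T\in\mathbb{R}^{n\times n}$. Let $g\in\mathbb{R}^n$, $T=\Psi^T\Psi$ and $\bar u=\Psi^T g$. Suppose that $(V,\Lambda)$ solves the generalized eigenvalue problem $Mv=\lambda Tv$, i.e. $V\in\mathbb{R}^{m\times m}$ and $\Lambda\in\mathbb{R}^{m\times m}$ is diagonal with $MV=TV\Lambda$ and $V^TTV=I$. Then in the spectral decomposition $$B=U\begin{pmatrix}\gamma I_{n-m}&0\\0&\hat\Lambda\end{pmatrix}U^T,\qquad U=\begin{pmatrix}U_1&U_2\end{pmatrix}\ \text{orthogonal},$$ one may take $U_2=\Psi V$ and $\hat\Lambda=\gamma I+\Lambda^{-1}$; that is, $\Psi V$ has orthonormal columns, $\Lambda$ is invertible, and for every $U_1\in\mathbb{R}^{n\times(n-m)}$ such that $U=\begin{pmatrix}U_1&\Psi V\end{pmatrix}$ is orthogonal, the displayed identity holds with $\hat\Lambda=\gamma I+\Lambda^{-1}$. Moreover, writing $\hat g_1=U_1^Tg$ and $\hat g_2=U_2^Tg$, we have $\hat g_2=V^T\bar u$ and $\|\hat g_1\|^2=g^Tg-\hat g_2^T\hat g_2$.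
   Context: $\|\cdot\|$ is the Euclidean norm. Limited-memory quasi-Newton Hessian approximations (such as limited-memory SR1 or BFGS) have the compact form $B=\gamma I+\Psi M^{-1}\Psi^T$, with $\Psi$ having few columns compared with the dimension $n$. *)

(* Defs.v *)
From mathcomp Require Import all_boot all_order all_algebra.
From mathcomp Require Import reals.
Set Implicit Arguments.
Unset Strict Implicit.
Unset Printing Implicit Defensive.
Import GRing.Theory Num.Theory.
Local Open Scope ring_scope.

Definition orthonormal_cols (R : realType) (p q : nat) (A : 'M[R]_(p, q)) : Prop :=
  A^T *m A = 1%:M.

(* The two dimensions are kept apart so that a matrix of type
   'M_(n, n - m + m), square only up to a cast, can be called orthogonal;
   the two equations together force p = q. *)
Definition orthogonal_mx (R : realType) (p q : nat) (U : 'M[R]_(p, q)) : Prop :=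
  U^T *m U = 1%:M /\ U *m U^T = 1%:M.

(* The norm `|x| on matrices in MathComp-Analysis is the sup norm,
   hence this definition. *)
Definition enorm (R : realType) (p : nat) (x : 'cV[R]_p) : R :=
  Num.sqrt (\sum_(i < p) x i 0 ^+ 2).

(* Main.v *)
Require Import Defs.
From mathcomp Require Import all_boot all_order all_algebra.
From mathcomp Require Import reals.
Set Implicit Arguments.
Unset Strict Implicit.
Unset Printing Implicit Defensive.
Import GRing.Theory Num.Theory.
Local Open Scope ring_scope.

(** The normalization [V^T T V = 1] turns the eigenvalue equation
    [M V = T V L] into the congruence [V^T M V = L].  As [V] is square, hence
    invertible, [L] is invertible along with [M], and inverting the congruence
    gives [M^-1 = V L^-1 V^T] ([invmx_pencil]).  With [U2 = Psi V] the low-rank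
    part of [B] is therefore [U2 L^-1 U2^T].

    When [U = (U1 U2)] is orthogonal, [U U^T = 1] reads
    [U1 U1^T + U2 U2^T = 1].  Multiplied by [gamma], this resolution of the
    identity distributes the shift [gamma I] over the two diagonal blocks
    ([shift_update_block]); placed between [g^T] and [g], it is the Pythagorean
    splitting [g^T g = g1^T g1 + g2^T g2] of the squared norm
    ([gram_split]). *)

Section CompactForm.
Variable R : comUnitRingType.

Section Pencil.
Variables (m : nat) (M T V L : 'M[R]_m).
Hypotheses (M_unit : M \in unitmx) (eigMT : M *m V = T *m V *m L).
Hypothesis (V_orth : V^T *m T *m V = 1%:M).

Lemma unitmx_pencil : L \in unitmx.
Proof.
have <- : V^T *m M *m V = L by rewrite -mulmxA eigMT !mulmxA V_orth mul1mx.
have [_ V_unit] := mulmx1_unit V_orth.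
by rewrite !unitmx_mul unitmx_tr V_unit M_unit.
Qed.

(** A left inverse of a square matrix is a right inverse, so the
    normalization also gives [(T V) V^T = 1]; this is what remains of
    [M (V L^-1 V^T)] once [M V] is replaced by [T V L]. *)
Lemma invmx_pencil : invmx M = V *m invmx L *m V^T.
Proof.
have TVVt : T *m V *m V^T = 1%:M by apply: mulmx1C; rewrite mulmxA.
have MW : M *m (V *m invmx L *m V^T) = 1%:M.
  by rewrite !mulmxA eigMT (mulmxK unitmx_pencil).
by rewrite -[RHS](mulKmx M_unit) MW mulmx1.
Qed.

End Pencil.

Section Splitting.
Variables (n p q : nat) (U1 : 'M[R]_(n, p)) (U2 : 'M[R]_(n, q)).
Hypothesis U_coiso : row_mx U1 U2 *m (row_mx U1 U2)^T = 1%:M.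

Lemma shift_update_block (c : R) (D : 'M[R]_q) :
  c%:M + U2 *m D *m U2^T =
  row_mx U1 U2 *m block_mx c%:M 0 0 (c%:M + D) *m (row_mx U1 U2)^T.
Proof.
rewrite -{1}[c%:M]mulmx1 -U_coiso tr_row_mx mul_row_block !mul_row_col.
rewrite !mulmx0 addr0 add0r !mulmxDr mulmxDl addrA.
by rewrite !mul_scalar_mx !mul_mx_scalar -!scalemxAl.
Qed.

Lemma gram_split k (g : 'M[R]_(n, k)) :
  g^T *m g =
  (U1^T *m g)^T *m (U1^T *m g) + (U2^T *m g)^T *m (U2^T *m g).
Proof.
rewrite -{1}[g^T]mulmx1 -U_coiso tr_row_mx mul_row_col.
by rewrite !trmx_mul !trmxK mulmxDr mulmxDl !mulmxA.
Qed.

End Splitting.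

End CompactForm.

Lemma enorm_sqr (R : realType) p (x : 'cV[R]_p) :
  enorm x ^+ 2 = (x^T *m x) 0 0.
Proof.
rewrite sqr_sqrtr; last by apply: sumr_ge0 => i _; exact: sqr_ge0.
by rewrite mxE; apply: eq_bigr => i _; rewrite mxE expr2.
Qed.

Theorem theorem2 (R : realType) (m n : nat) (m_gt0 : (0 < m)%N) (m_lt_n : (m < n)%N)
  (gamma : R) (Psi : 'M[R]_(n, m)) (Psi_full : \rank Psi = m)
  (M : 'M[R]_m) (M_sym : M^T = M) (M_unit : M \in unitmx)
  (g : 'cV[R]_n) (V Lambda : 'M[R]_m) :
  let B : 'M[R]_n := gamma%:M + Psi *m invmx M *m Psi^T in
  let T : 'M[R]_m := Psi^T *m Psi in
  let ubar : 'cV[R]_m := Psi^T *m g in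
  is_diag_mx Lambda ->
  M *m V = T *m V *m Lambda ->
  V^T *m T *m V = 1%:M ->
  let U2 : 'M[R]_(n, m) := Psi *m V in
  let hatLambda : 'M[R]_m := gamma%:M + invmx Lambda in
  let hatg2 : 'cV[R]_m := U2^T *m g in
  [/\ orthonormal_cols U2,
      Lambda \in unitmx,
      hatg2 = V^T *m ubar
    & forall U1 : 'M[R]_(n, n - m),
        let U := row_mx U1 U2 in
        let hatg1 : 'cV[R]_(n - m) := U1^T *m g in
        orthogonal_mx U ->
        B = U *m block_mx (gamma%:M : 'M[R]_(n - m)) 0 0 hatLambda *m U^T /\
        enorm hatg1 ^+ 2 = (g^T *m g) 0 0 - (hatg2^T *m hatg2) 0 0].
Proof.
move=> B T ubar _ eigMT V_orth U2 hatLambda hatg2; split.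
- by rewrite /orthonormal_cols trmx_mul -V_orth !mulmxA.
- exact: unitmx_pencil M_unit eigMT V_orth.
- by rewrite /hatg2 trmx_mul mulmxA.
move=> U1 U hatg1 [_ U_coiso]; split; last first.
  by rewrite enorm_sqr (gram_split U_coiso g) [in RHS]mxE addrK.
rewrite -(shift_update_block U_coiso gamma (invmx Lambda)) /B.
by rewrite (invmx_pencil M_unit eigMT V_orth) trmx_mul !mulmxA.
Qed.
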